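(* Let $\Sigma$ be a finite nonempty alphabet, let $m, n$ be integers with $0 < m < n < 2m$, and let $S \subseteq \Sigma^m \cup \Sigma^n$ be such that $S^*$ is co-finite. Then $S^* \ne \Sigma^*$, and every word in $\Sigma^* \setminus S^*$ has length at most $g(m,l) = ml - m - l$, where $l = m|\Sigma|^{n-m} + n - m$.
   Context: $\Sigma^j$ denotes the set of words of length exactly $j$ over $\Sigma$. A language $L \subseteq \Sigma^*$ is co-finite if $\Sigma^* \setminus L$ is finite. *)

(* Defs.v *)
From mathcomp Require Import all_boot all_order all_algebra.
From mathcomp Require Import classical_sets cardinality.

Set Implicit Arguments.
Unset Strict Implicit.
Unset Printing Implicit Defensive.

Local Open Scope classical_set_scope.

Definition language (Sigma : finType) := set (seq Sigma).

Definition words (Sigma : finType) (j : nat) : language Sigma :=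
  [set w | size w = j].

Definition star (Sigma : finType) (L : language Sigma) : language Sigma :=
  [set w | exists2 us : seq (seq Sigma),
             (forall u, u \in us -> L u) & w = flatten us].

Definition cofinite (Sigma : finType) (L : language Sigma) : Prop :=
  finite_set (~` L).

(* Valued in int, so that the subtractions are not truncated. *)
Definition g (a b : nat) : int := (a%:Z * b%:Z - a%:Z - b%:Z)%R.

(* Main.v *)
Require Import Defs.
From mathcomp Require Import all_boot all_order all_algebra.
From mathcomp Require Import classical_sets cardinality.
From mathcomp Require Import boolp zify.

Set Implicit Arguments.
Unset Strict Implicit.
Unset Printing Implicit Defensive.

Local Open Scope classical_set_scope.

(** Write [d = n - m] and [q = #|Sigma| ^ d], so that [l = m q + d].
    - [S] contains every word [u] of length [m]: otherwise, for any [z] of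
      length [d] and any letter [x], the words [(u z)^k x] can only be parsed
      by reading [u z] over and over, which leaves [x], and [1 < m].
    - [S] contains a factor of length [n] starting at a multiple of [m] in every
      word [w] of length [l]: among the [q + 1] factors of length [d] of [w]
      starting at multiples of [m], two coincide; if [S] missed all the aligned
      factors of length [n], then repeating the part of [w] between the two
      equal ones would give arbitrarily long words of length [d] modulo [m] that
      have no parsing.
    Hence the star of [S] contains all words of lengths [m] and [l], and these
    lengths are coprime, so that it contains all words longer than their
    Frobenius number. *)

Section Star.

Variable Sigma : finType.
Implicit Types (L : language Sigma) (u v w : seq Sigma).

Lemma star_nil L : star L [::].
Proof. by exists [::]. Qed.

Lemma star_incl L u : L u -> star L u.
Proof.
by move=> Lu; exists [:: u]; rewrite /= ?cats0 // => v; rewrite inE => /eqP ->.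
Qed.

Lemma star_cat L u v : star L u -> star L v -> star L (u ++ v).
Proof.
move=> [us Lus ->] [vs Lvs ->]; exists (us ++ vs); last by rewrite flatten_cat.
by move=> x; rewrite mem_cat => /orP[/Lus|/Lvs].
Qed.

Lemma star_case L w : star L w ->
  w = [::] \/ exists u v, [/\ L u, star L v & w = u ++ v].
Proof.
move=> [[|u us] Lus ->]; [by left | right].
exists u, (flatten us); split=> //; first by apply: Lus; rewrite mem_head.
by exists us => // v vus; apply: Lus; rewrite in_cons vus orbT.
Qed.

Lemma star_words_mul L a k : words a `<=` star L -> words (k * a) `<=` star L.
Proof.
move=> La; elim: k => [|k IHk] w; rewrite /words /= ?mulSn => sz_w.
  by rewrite (size0nil sz_w); exact: star_nil.
rewrite -(cat_take_drop a w); apply: star_cat.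
  by apply: La; rewrite /words /= size_takel //; lia.
by apply: IHk; rewrite /words /= size_drop; lia.
Qed.

Lemma star_words_lincomb L a b i j :
    words a `<=` star L -> words b `<=` star L ->
  words (i * a + j * b) `<=` star L.
Proof.
move=> La Lb w; rewrite /words /= => sz_w.
rewrite -(cat_take_drop (i * a) w); apply: star_cat.
  by apply: (star_words_mul (k := i) La); rewrite /words /= size_takel //; lia.
by apply: (star_words_mul (k := j) Lb); rewrite /words /= size_drop; lia.
Qed.

Lemma star_dvdn_size L e : (forall u, L u -> e %| size u) ->
  forall w, star L w -> e %| size w.
Proof.
move=> Le w [us Lus ->]; elim: us Lus => [|u us IHus] Lus; first exact: dvdn0.
rewrite /= size_cat dvdn_add //; first by apply/Le/Lus; rewrite mem_head.
by apply: IHus => v vus; apply: Lus; rewrite in_cons vus orbT.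
Qed.

Lemma cofinite_long_words L : cofinite L ->
  exists N, forall w, N < size w -> L w.
Proof.
move=> /finite_seqP[s Ls]; exists (\max_(u <- s) size u) => w lt_w.
apply: contrapT => nLw; have : w \in s by have : (~` L) w by []; rewrite Ls.
by move=> ws; have := @leq_bigmax_seq _ _ _ size _ ws isT; rewrite leqNgt lt_w.
Qed.

End Star.

(** Take the least [j] with [j * b] congruent to [N] modulo [a]. As [j < a], the bound gives
    [j * b < N + a]; if [j * b] exceeded [N], the difference would be a positive multiple of [a]
    below [a]. *)
Lemma coprime_frobenius a b N : 0 < a -> coprime a b -> a * b < N + a + b ->
  exists i j, N = i * a + j * b.
Proof.
move=> a_gt0 co_ab lt_N; have /dvdnP[k Ek] : b %| chinese a b N 0.
  by rewrite /dvdn chinese_modr // mod0n.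
set j := k %% a; have lt_ja : j < a by rewrite ltn_mod.
have Ej : j * b = N %[mod a] by rewrite modnMml -Ek chinese_modl.
have le_jb : j * b + b <= a * b by rewrite addnC -mulSn leq_mul2r lt_ja orbT.
have [le_jN|lt_Nj] := leqP (j * b) N.
  have /dvdnP[i Ei] : a %| N - j * b by rewrite -eqn_mod_dvd // Ej.
  by exists i, j; rewrite -Ei subnK.
have /dvdn_leq : a %| j * b - N by rewrite -eqn_mod_dvd ?Ej // ltnW.
by lia.
Qed.

Section TwoLengths.

Variables (Sigma : finType) (m n : nat) (S : language Sigma).
Hypotheses (Sigma_nonempty : 0 < #|Sigma|) (lt_mn : m < n) (lt_n2m : n < 2 * m).
Hypotheses (subS : S `<=` words m `|` words n) (cofS : cofinite (star S)).

Let x0 : Sigma := enum_val (Ordinal Sigma_nonempty).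

Lemma star_no_short_word w : 0 < size w < m -> ~ star S w.
Proof.
move=> sz_w /star_case[w0|[u [v [/subS Su _ Ew]]]]; first by rewrite w0 in sz_w.
have le_mu : m <= size u by case: Su => ->; rewrite ?(ltnW lt_mn).
case/andP: sz_w => _; rewrite Ew size_cat ltnNge.
by rewrite (leq_trans le_mu) ?leq_addr.
Qed.

Lemma words_sub_of_cofinite : words m `<=` S.
Proof.
move=> u; rewrite /words /= => sz_u; apply: contrapT => nSu.
pose z := nseq (n - m) x0.
pose W k := flatten (nseq k (u ++ z)) ++ [:: x0].
have sz_W k : k < size (W k).
  rewrite size_cat addn1 ltnS; elim: k => //= k IHk.
  by rewrite !size_cat sz_u; lia.
have nW k : ~ star S (W k).
  elim: k => [|k IHk]; first by apply: star_no_short_word; rewrite /=; lia.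
  case/star_case=> [W0|[y [v [Sy Sv Ew]]]].
    by have := sz_W k.+1; rewrite W0.
  have [sz_y|sz_y] := subS Sy.
    apply: nSu; suff -> : u = y by [].
    have := congr1 (take m) Ew; rewrite /W /= -!catA take_size_cat //.
    by rewrite take_size_cat.
  (* A first block of length [n = m + (n - m)] is exactly [u ++ z]. *)
  apply: IHk; suff -> : W k = v by [].
  have := congr1 (drop n) Ew; rewrite (drop_size_cat _ sz_y) => <-.
  by rewrite /W /= -catA drop_size_cat // size_cat sz_u size_nseq; lia.
by have [N long] := cofinite_long_words cofS; apply: (nW N); apply: long.
Qed.

(** As long as only blocks of length [m] have been read, the position is a multiple of [m], so a
    block of length [n] read next would be an aligned factor in [S]. Hence all blocks have length
    [m]. *)
Lemma star_no_aligned_factor w :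
    (forall t, t * m + n <= size w -> ~ S (take n (drop (t * m) w))) ->
  star S w -> m %| size w.
Proof.
move=> noS [us Sus Ew]; rewrite {w}Ew in noS *.
elim: us noS Sus => [|u us IHus] noS Sus; first exact: dvdn0.
have Su : S u by apply: Sus; rewrite mem_head.
rewrite /= in noS *; rewrite size_cat in noS *.
have [sz_u|sz_u] := subS Su; last first.
  have := noS 0; rewrite mul0n add0n drop0 -{1}sz_u leq_addr => /(_ isT).
  by rewrite take_size_cat.
rewrite sz_u dvdn_addr //; apply: IHus => // [t le_t|v vus].
  have := noS t.+1; rewrite mulSn sz_u -addnA leq_add2l => /(_ le_t).
  by rewrite addnC -drop_drop drop_size_cat.
by apply: Sus; rewrite in_cons vus orbT.
Qed.

Lemma aligned_factor_of_cofinite w :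
    size w = m * #|Sigma| ^ (n - m) + (n - m) ->
  exists2 t, t < #|Sigma| ^ (n - m) & S (take n (drop (t * m) w)).
Proof.
set d := n - m; set q := #|Sigma| ^ d => sz_w; apply: contrapT => noS.
(* These factors stay inside [w] even for [i = q], since [q * m + d = size w]. *)
pose f (i : 'I_q.+1) := [tuple nth x0 w (i * m + s) | s < d].
have [i [j [lt_ij Eij]]] : exists i j : 'I_q.+1, i < j /\ f i = f j.
  have /injectivePn[i [j neq_ij Eij]] : ~~ injectiveb f.
    apply/negP=> /injectiveP/leq_card.
    by rewrite card_tuple card_ord ltnn.
  have [lt_ij|lt_ji|/val_inj E] := ltngtP i j; first by exists i, j.
    by exists j, i.
  by rewrite E eqxx in neq_ij.
have {}Eij s : s < d -> nth x0 w (i * m + s) = nth x0 w (j * m + s).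
  move=> lt_sd; have := congr1 (fun t => tnth t (Ordinal lt_sd)) Eij.
  by rewrite !tnth_mktuple.
pose p := j - i.
(* The part of [w] from [i * m] to [j * m] is read [k] times, then [d] letters more. Since
   [0 < d < m], the length is no multiple of [m]. *)
pose W k := mkseq (fun a => nth x0 w (i * m + a %% (p * m))) (k * p * m + d).
have sz_W k : size (W k) = k * p * m + d by rewrite size_mkseq.
have le_jq : j <= q by rewrite -ltnS.
have nW k : ~ star S (W k).
  move/star_no_aligned_factor=> dvW.
  have /dvW : forall t, t * m + n <= size (W k) ->
      ~ S (take n (drop (t * m) (W k))).
    move=> t le_t St; apply: noS.
    have p_gt0 : 0 < p by rewrite subn_gt0.
    (* The factor of [W k] at [t * m] is a copy of the one of [w] at [(i + r) * m]. *)
    set r := t %% p; have lt_rp : r < p by rewrite ltn_mod.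
    have le_rp : r.+1 * m <= p * m by rewrite leq_mul2r lt_rp orbT.
    have Ejm : j * m = i * m + p * m by rewrite -mulnDl subnKC // ltnW.
    have le_jm : j * m <= m * q by rewrite mulnC leq_mul2l le_jq orbT.
    have Erm : (i + r) * m = i * m + r * m by rewrite mulnDl.
    exists (i + r); first by rewrite /p in lt_rp; lia.
    suff <- : take n (drop (t * m) (W k)) = take n (drop ((i + r) * m) w) by [].
    apply: (@eq_from_nth _ x0) => [|s].
      rewrite !size_takel // size_drop ?sz_W ?sz_w; first by lia.
      by rewrite -sz_W; lia.
    rewrite size_takel => [lt_sn|]; last by rewrite size_drop; lia.
    rewrite !nth_take // !nth_drop nth_mkseq; last by rewrite -sz_W; lia.
    have -> : t * m + s = r * m + s %[mod p * m].
      by rewrite {1}(divn_eq t p) mulnDl -mulnA -addnA modnMDl.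
    have [lt_s|ge_s] := ltnP (r * m + s) (p * m).
      by rewrite modn_small // Erm addnA.
    (* As [s < n < 2 * m], passing the end of the period forces [r = p - 1], and the overrun [s - m]
       is below [d]: there [w] reads the same from [i * m] as from [j * m]. *)
    have Er : p * m = r.+1 * m.
      have [lt_r|ge_r] := ltnP r.+1 p; last by congr muln; lia.
      have : r.+2 * m <= p * m by rewrite leq_mul2r lt_r orbT.
      by lia.
    have Ers : r * m + s = p * m + (s - m) by lia.
    rewrite Ers modnDl modn_small; last by lia.
    by rewrite Eij; [congr nth; lia | lia].
  by rewrite sz_W dvdn_addr ?dvdn_mull // => /dvdn_leq; lia.
have [N long] := cofinite_long_words cofS; apply: (nW N.+1); apply: long.
rewrite sz_W -mulnA.
have : N.+1 * 1 <= N.+1 * (p * m).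
  by rewrite leq_mul2l /= muln_gt0 subn_gt0 lt_ij; lia.
by lia.
Qed.

Lemma star_words_of_cofinite :
  words (m * #|Sigma| ^ (n - m) + (n - m)) `<=` star S.
Proof.
set d := n - m; set q := #|Sigma| ^ d => w sz_w.
have [t lt_tq St] := aligned_factor_of_cofinite sz_w.
have Sm : words m `<=` star S.
  by move=> u /words_sub_of_cofinite; exact: star_incl.
(* Around the factor of length [n = m + d] remain [t * m] letters before and [e * m] after. *)
have [e Eq] : exists e, m * q = t * m + m + e * m.
  exists (q - t.+1); rewrite -/d -/q in lt_tq.
  by rewrite -{1}(subnKC lt_tq) mulnC mulnDl mulSn [m + _]addnC.
rewrite /words /= -/d -/q Eq in sz_w.
rewrite -(cat_take_drop (t * m) w) -(cat_take_drop n (drop (t * m) w)).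
apply: star_cat.
  by apply: (star_words_mul (k := t) Sm); rewrite /words /= size_takel; lia.
apply: star_cat; first exact: star_incl.
by apply: (star_words_mul (k := e) Sm); rewrite /words /= !size_drop; lia.
Qed.

(** The gcd divides the length of every word of [star S], hence two consecutive large integers. *)
Lemma coprime_of_cofinite : coprime m n.
Proof.
have [N long] := cofinite_long_words cofS.
have dvS w : star S w -> gcdn m n %| size w.
  by apply: star_dvdn_size => u /subS[] ->; rewrite ?dvdn_gcdl ?dvdn_gcdr.
have dv k : N < k -> gcdn m n %| k.
  by move=> lt_Nk; rewrite -(size_nseq k x0); apply/dvS/long; rewrite size_nseq.
rewrite /coprime -dvdn1 -(dvdn_addr _ (dv N.+1 _)) //.
by apply: dv; rewrite addn1 ltnW.
Qed.

End TwoLengths.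

Theorem theorem20 (Sigma : finType) (m n : nat) (S : language Sigma)
  (Sigma_nonempty : 0 < #|Sigma|)
  (m_gt0 : 0 < m) (lt_mn : m < n) (lt_n2m : n < 2 * m)
  (subS : S `<=` words m `|` words n)
  (cofS : cofinite (star S)) :
  let l := m * #|Sigma| ^ (n - m) + (n - m) in
  star S <> setT /\
  (forall w : seq Sigma, (~` star S) w -> ((size w)%:Z <= g m l)%R).
Proof.
move=> l; split=> [S_T|w nSw].
  pose x0 : Sigma := enum_val (Ordinal Sigma_nonempty).
  have : star S [:: x0] by rewrite S_T.
  (* The inequalities [m < n < 2 * m] force [1 < m]. *)
  by apply: (star_no_short_word lt_mn subS); rewrite /=; lia.
apply: contrapT => /negP lt_w; apply: nSw.
have Sm : words m `<=` star S.
  by move=> u /(words_sub_of_cofinite Sigma_nonempty lt_mn lt_n2m subS cofS);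
    exact: star_incl.
have Sl : words l `<=` star S by exact: star_words_of_cofinite.
have co_ml : coprime m l.
  (* Modulo [m], both [l] and [n] reduce to [n - m]. *)
  rewrite /l /coprime mulnC gcdnMDl -(gcdnMDl 1) mul1n subnKC ?(ltnW lt_mn) //.
  exact: (coprime_of_cofinite Sigma_nonempty subS cofS).
have [|i [j Ew]] := @coprime_frobenius m l (size w) m_gt0 co_ml.
  by rewrite /g in lt_w; lia.
exact: (star_words_lincomb Sm Sl Ew).
Qed.
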